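(* Let $c\in(0,\infty]$. The $U(1)$-action on $C(S^2_{qc})$ and the reflection $\bar r_1^c$ are compatible: $\delta_g\circ\bar r_1^c=\bar r_1^c\circ\delta_g$ for every $g\in U(1)$.
   Context: Fix $q\in\mathbb{R}$ with $0<|q|<1$. All algebras are unital and over $\mathbb{C}$. The $C^*$-closure of a $*$-algebra means the completion with respect to the supremum norm over all $*$-representations in bounded operators. $C(S^2_{q\infty})$ is the $C^*$-closure of $P(S^2_{q\infty})$, the quotient of the free $*$-algebra $\mathbb{C}\langle A,B\rangle$ by the two-sided $*$-ideal generated by $A^*=A$, $BA=q^2AB$, $B^*B=-A^2+I$, $BB^*=-q^4A^2+I$. For $c\in(0,\infty)$, $C(S^2_{qc})$ is the $C^*$-closure of $P(S^2_{qc})$, the quotient of $\mathbb{C}\langle A_c,B_c\rangle$ by the two-sided $*$-ideal generated by $A_c^*=A_c$, $B_cA_c=q^2A_cB_c$, $B_c^*B_c=A_c-A_c^2+cI$, $B_cB_c^*=q^2A_c-q^4A_c^2+cI$. For $c=\infty$ we write $A_\infty=A$, $B_\infty=B$. Let $\{e_k\}_{k\in\mathbb{N}}$ ($k\ge 0$) be an orthonormal basis of a Hilbert space. The representations $\pi_\pm=\pi^\infty_\pm$ of $C(S^2_{q\infty})$ are given by $\pi_\pm(A)e_k=\pm q^{2k}e_k$, $\pi_\pm(B)e_k=(1-q^{4k})^{1/2}e_{k-1}$ for $k\ge1$, $\pi_\pm(B)e_0=0$. For $c\in(0,\infty)$ the representations $\pi^c_\pm$ of $C(S^2_{qc})$ are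 given by $\pi^c_\pm(A_c)e_k=\lambda_\pm q^{2k}e_k$, $\pi^c_\pm(B_c)e_k=c_\pm(k)^{1/2}e_{k-1}$ for $k\ge1$, $\pi^c_\pm(B_c)e_0=0$, where $\lambda_\pm=\frac12\pm(c+\frac14)^{1/2}$ and $c_\pm(k)=\lambda_\pm q^{2k}-(\lambda_\pm q^{2k})^2+c$. Let $C^*(\mathfrak{S})$ be the $C^*$-algebra generated by the one-sided shift $\mathfrak{S}e_i=e_{i+1}$, $\sigma:C^*(\mathfrak{S})\to C(S^1)$ the symbol map ($\mathfrak{S}\mapsto u$, the unitary generator of $C(S^1)$), and $C^*(\mathfrak{S})\oplus_\sigma C^*(\mathfrak{S}):=\{(a_1,a_2)\mid\sigma(a_1)=\sigma(a_2)\}$. It is known that for all $c\in(0,\infty]$, $\pi_+^c\oplus\pi_-^c:C(S^2_{qc})\to C^*(\mathfrak{S})\oplus_\sigma C^*(\mathfrak{S})$ is a $C^*$-isomorphism. Let $\tau(a,b)=(b,a)$ be the flip on $C^*(\mathfrak{S})\oplus_\sigma C^*(\mathfrak{S})$. Put $\bar r_1:=(\pi_+\oplus\pi_-)^{-1}\circ\tau\circ(\pi_+\oplus\pi_-)$, $\chi_c:=(\pi_+\oplus\pi_-)^{-1}\circ(\pi^c_+\oplus\pi^c_-):C(S^2_{qc})\to C(S^2_{q\infty})$, and $\bar r_1^c:=\chi_c^{-1}\circ\bar r_1\circ\chi_c$ (so $\bar r_1^\infty=\bar r_1$). For $g\in U(1)$, $\delta_g$ is the $C^*$-automorphism of $C(S^2_{qc})$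 determined by $\delta_g(A_c)=A_c$, $\delta_g(B_c)=g^2B_c$. *)

(* Defs.v *)
From HB Require Import structures.
From mathcomp Require Import all_boot all_order all_algebra.
From mathcomp Require Import sesquilinear generic_quotient.
From mathcomp Require Import all_classical all_reals all_analysis.
From mathcomp Require Import finmap complex.
(* The notations of monalg clash with those of all_analysis. *)
From mathcomp Require Import -(notations) monalg.

Set Implicit Arguments.
Unset Strict Implicit.
Unset Printing Implicit Defensive.

Import Order.TTheory GRing.Theory Num.Theory numFieldNormedType.Exports.

Local Open Scope classical_set_scope.
Local Open Scope ring_scope.

HB.mixin Record isStarAlgebra (R : realType) A of GRing.Algebra R[i] A := {
  star : A -> A;
  starK : involutive star;
  starD : {morph star : x y / x + y};
  starZ : forall (a : R[i]) (x : A), star (a *: x) = Num.conj a *: star x;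
  starM : forall x y : A, star (x * y) = star y * star x
}.

#[short(type="starAlgType")]
HB.structure Definition StarAlgebra (R : realType) :=
  {A of isStarAlgebra R A & GRing.Algebra R[i] A}.

Lemma star0 (R : realType) (F : starAlgType R) : star 0 = 0 :> F.
Proof. by rewrite -[X in star X](scale0r 0) starZ rmorph0 scale0r. Qed.
Lemma star1 (R : realType) (F : starAlgType R) : star 1 = 1 :> F.
Proof. by rewrite -[LHS]mul1r -[X in X * _](starK 1) -starM mul1r starK. Qed.
Lemma starN (R : realType) (F : starAlgType R) (x : F) : star (- x) = - star x.
Proof. by rewrite -scaleN1r starZ rmorphN rmorph1 scaleN1r. Qed.

(* The norm is a separate real-valued field: the algebraic hierarchy has no join
   of noncommutative rings with normed modules. *)
HB.mixin Record isCStarAlgebra (R : realType) A of StarAlgebra R A := {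
  cnorm : A -> R;
  cnorm_eq0 : forall x, cnorm x = 0 -> x = 0;
  cnormD : forall x y, cnorm (x + y) <= cnorm x + cnorm y;
  cnormZ : forall (a : R[i]) x, cnorm (a *: x) = complex.Re `|a| * cnorm x;
  cnormM : forall x y, cnorm (x * y) <= cnorm x * cnorm y;
  cnorm_star : forall x, cnorm (star x * x) = cnorm x ^+ 2;
  cnorm_complete : forall u : nat -> A,
    (forall eps : R, 0 < eps -> exists N : nat, forall m n : nat,
        (N <= m)%N -> (N <= n)%N -> cnorm (u m - u n) < eps) ->
    exists l : A, (fun n => cnorm (u n - l)) @ \oo --> (0 : R)
}.

#[short(type="cstarAlgType")]
HB.structure Definition CStarAlgebra (R : realType) :=
  {A of isCStarAlgebra R A & StarAlgebra R A}.

(* The inner product is linear in its first argument. *)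
HB.mixin Record isHilbert (R : realType) H of CompleteNormedModule R[i] H := {
  inner : {dot H for Num.conj};
  norm_inner : forall x : H, `|x| ^+ 2 = inner x x
}.

#[short(type="hilbertType")]
HB.structure Definition Hilbert (R : realType) :=
  {H of CompleteNormedModule R[i] H & isHilbert R H}.

Section FreeStarAlgebra.
Variables (C : numClosedFieldType) (I : choiceType).

(* Words in the letters (i, false) = X_i and (i, true) = X_i^*. *)
Definition word := fmonom (I * bool)%type.

Definition word_star (w : word) : word :=
  fmonom_of_seq fmonom_key (rev [seq (l.1, ~~ l.2) | l <- w : seq _]).

Local Notation FA := (malg word C).

Definition free_star (x : FA) : FA :=
  \sum_(w <- msupp x) mkmalgU (word_star w) (Num.conj (mcoeff w x)).

Lemma word_starK : involutive word_star.
Proof.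
move=> w; apply/eqP; rewrite fmP /word_star !fmE /= map_rev revK -map_comp.
by rewrite (@eq_map _ _ _ idfun) ?map_id // => -[i b] /=; rewrite negbK.
Qed.

Lemma word_starM (v w : word) : word_star (mul v w) = mul (word_star w) (word_star v).
Proof.
apply/eqP; rewrite fmP /word_star !fmE fmM /= fmM /= map_cat rev_cat.
by [].
Qed.

Lemma mcoeff_free_star (x : FA) w :
  mcoeff w (free_star x) = Num.conj (mcoeff (word_star w) x).
Proof.
rewrite /free_star raddf_sum /=.
have [wx|wx] := boolP (word_star w \in msupp x).
  rewrite (big_fsetD1 _ wx) /= mcoeffU word_starK eqxx mulr1n big1_fset ?addr0 //.
  move=> v; rewrite in_fsetD1 => /andP[vw _] _; rewrite mcoeffU.
  by case: eqP => [E|//]; move: vw; rewrite -E word_starK eqxx.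
rewrite mcoeff_outdom // rmorph0 big1_fset // => v vx _; rewrite mcoeffU.
by case: eqP => [E|//]; move: wx; rewrite -E word_starK vx.
Qed.

Lemma free_starK : involutive free_star.
Proof.
by move=> x; apply/malgP => w; rewrite !mcoeff_free_star word_starK conjCK.
Qed.

Lemma free_starD : {morph free_star : x y / x + y}.
Proof.
move=> x y; apply/malgP => w.
rewrite [LHS]mcoeff_free_star [RHS]mcoeffD [X in Num.conj X]mcoeffD rmorphD.
by congr (_ + _); rewrite mcoeff_free_star.
Qed.

Lemma free_starZ (a : C) x : free_star (a *: x) = Num.conj a *: free_star x.
Proof.
apply/malgP => w.
rewrite [LHS]mcoeff_free_star [RHS]mcoeffZ [X in Num.conj X]mcoeffZ rmorphM.
by congr (_ * _); rewrite mcoeff_free_star.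
Qed.

Lemma free_starU (a : C) w :
  free_star (mkmalgU w a) = mkmalgU (word_star w) (Num.conj a).
Proof.
apply/malgP => v; rewrite mcoeff_free_star !mcoeffU rmorphMn /=.
by rewrite (can2_eq word_starK word_starK).
Qed.

Lemma free_star_sum (s : seq word) (F : word -> FA) :
  free_star (\sum_(w <- s) F w) = \sum_(w <- s) free_star (F w).
Proof.
apply: (big_morph free_star free_starD).
by apply/malgP => w; rewrite [LHS]mcoeff_free_star [in LHS]mcoeff0 rmorph0 [RHS]mcoeff0.
Qed.

Lemma mkmalgUM (a b : C) (v w : word) :
  mkmalgU v a * mkmalgU w b = mkmalgU (mul v w) (a * b) :> FA.
Proof. exact: fgmulUU. Qed.

Lemma free_starM x y : free_star (x * y) = free_star y * free_star x.
Proof.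
have HU v w (a b : C) : free_star (mkmalgU v a * mkmalgU w b) =
    free_star (mkmalgU w b) * free_star (mkmalgU v a).
  by rewrite mkmalgUM free_starU [in RHS]free_starU [in RHS]free_starU mkmalgUM
     word_starM rmorphM mulrC.
rewrite [x]monalgE [y]monalgE [X in free_star X]mulr_suml.
apply: (etrans (free_star_sum _ _)).
rewrite [X in _ = _ * X]free_star_sum [RHS]mulr_sumr; apply: eq_bigr => v _.
rewrite [X in free_star X]mulr_sumr; apply: (etrans (free_star_sum _ _)).
rewrite [X in _ = X * _]free_star_sum [RHS]mulr_suml.
by apply: eq_bigr => w _; exact: HU.
Qed.

Lemma free_scaleAr (a : C) (x y : FA) : a *: (x * y) = x * (a *: y).
Proof.
have scU (b : C) w : a *: mkmalgU w b = mkmalgU w (a * b) :> FA.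
  apply/malgP => v; rewrite [LHS]mcoeffZ [RHS]mcoeffU.
  by rewrite [X in _ * X = _](mcoeffU w b v) mulrnAr.
have HU v w (b d : C) : a *: (mkmalgU v b * mkmalgU w d) =
    mkmalgU v b * (a *: mkmalgU w d) :> FA.
  by rewrite mkmalgUM 2!scU mkmalgUM mulrCA.
rewrite [x]monalgE [y]monalgE [X in a *: X]mulr_suml [LHS]scaler_sumr [RHS]mulr_suml.
apply: eq_bigr => v _.
rewrite [X in a *: X]mulr_sumr [LHS]scaler_sumr [X in _ * X]scaler_sumr [RHS]mulr_sumr.
by apply: eq_bigr => w _; exact: HU.
Qed.

End FreeStarAlgebra.

Definition freeStar (R : realType) (I : choiceType) : Type := malg (word I) R[i].
HB.instance Definition _ (R : realType) (I : choiceType) := GRing.Lalgebra.on (@freeStar R I).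
HB.instance Definition _ (R : realType) (I : choiceType) :=
  GRing.Lalgebra_isAlgebra.Build R[i] (@freeStar R I) (@free_scaleAr R[i] I).
HB.instance Definition _ (R : realType) (I : choiceType) := isStarAlgebra.Build R (@freeStar R I)
  (@free_starK R[i] I) (@free_starD R[i] I) (@free_starZ R[i] I) (@free_starM R[i] I).

Definition free_gen (R : realType) (I : choiceType) (i : I) : freeStar R I :=
  mkmalgU (fmu (i, false)) 1.

Section StarIdeals.
Variables (R : realType) (A : starAlgType R).
Local Notation C := R[i].

Definition star_ideal (J : set A) : Prop :=
  [/\ J 0, forall x y, J x -> J y -> J (x + y),
      forall x y, J x -> J (y * x), forall x y, J x -> J (x * y)
    & forall x, J x -> J (star x)].

Definition star_ideal_gen (G : set A) : set A :=
  \bigcap_(J in [set J | star_ideal J /\ G `<=` J]) J.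

Lemma star_ideal_genP (G : set A) : star_ideal (star_ideal_gen G).
Proof.
split=> [J [[]]|x y Gx Gy J JG|x y Gx J JG|x y Gx J JG|x Gx J JG] //;
  have [[_ HD HMl HMr HS] _] := JG.
- by apply: HD; [exact: Gx|exact: Gy].
- by apply: HMl; exact: Gx.
- by apply: HMr; exact: Gx.
- by apply: HS; exact: Gx.
Qed.

Record properStarIdeal := ProperStarIdeal {
  ideal_set : set A;
  ideal_star : star_ideal ideal_set;
  ideal_proper : ~ ideal_set 1
}.

End StarIdeals.

Section Quotient.
Variables (R : realType) (A : starAlgType R) (I : properStarIdeal A).
Local Notation C := R[i].
Local Notation J := (ideal_set I).

Local Lemma JD x y : J x -> J y -> J (x + y). Proof. by case: (ideal_star I) => _ + _ _ _; apply. Qed.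
Local Lemma JMl x y : J x -> J (y * x). Proof. by case: (ideal_star I) => _ _ + _ _; apply. Qed.
Local Lemma JMr x y : J x -> J (x * y). Proof. by case: (ideal_star I) => _ _ _ + _; apply. Qed.
Local Lemma JS x : J x -> J (star x). Proof. by case: (ideal_star I) => _ _ _ _; apply. Qed.
Local Lemma JZ (a : C) x : J x -> J (a *: x).
Proof. by move=> Jx; rewrite -[x]mul1r scalerAl; apply: JMl. Qed.
Local Lemma JN x : J x -> J (- x). Proof. by move=> Jx; rewrite -scaleN1r; apply: JZ. Qed.

Definition ideal_rel : rel A := fun x y => `[< J (x - y) >].

Lemma ideal_rel_refl : reflexive ideal_rel.
Proof. by move=> x; apply/asboolP; rewrite subrr; have [] := ideal_star I. Qed.
Lemma ideal_rel_sym : symmetric ideal_rel.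
Proof. by move=> x y; apply/asboolP/asboolP => /JN; rewrite opprB. Qed.
Lemma ideal_rel_trans : transitive ideal_rel.
Proof.
move=> y x z /asboolP xy /asboolP yz; apply/asboolP.
by rewrite -(subrKA y); apply: JD.
Qed.

Definition ideal_equiv : equiv_rel A :=
  EquivRel ideal_rel ideal_rel_refl ideal_rel_sym ideal_rel_trans.

Local Open Scope quotient_scope.

Definition starQuot := {eq_quot ideal_equiv}.
HB.instance Definition _ := EqQuotient.on starQuot.
HB.instance Definition _ := Choice.on starQuot.

Definition quot_proj (x : A) : starQuot := \pi_starQuot x.

Lemma quot_projP x y : quot_proj x = quot_proj y <-> J (x - y).
Proof.
split=> [/eqquotP|Jxy]; first by move/asboolP.
by apply/eqquotP; apply/asboolP.
Qed.

Lemma quot_projK (x : starQuot) : quot_proj (repr x) = x.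
Proof. exact: reprK. Qed.

Local Lemma quot_ind (P : starQuot -> Prop) : (forall x, P (quot_proj x)) -> forall x, P x.
Proof. by move=> H x; rewrite -[x]quot_projK. Qed.

Local Lemma repr_proj x : J (repr (quot_proj x) - x).
Proof. by apply/quot_projP; rewrite quot_projK. Qed.
#[local] Hint Resolve repr_proj : core.

Definition quot_add (x y : starQuot) := quot_proj (repr x + repr y).
Definition quot_opp (x : starQuot) := quot_proj (- repr x).
Definition quot_mul (x y : starQuot) := quot_proj (repr x * repr y).
Definition quot_scale (a : C) (x : starQuot) := quot_proj (a *: repr x).
Definition quot_star (x : starQuot) := quot_proj (star (repr x)).

Local Lemma quot_addE x y : quot_add (quot_proj x) (quot_proj y) = quot_proj (x + y).
Proof. by apply/quot_projP; rewrite opprD addrACA; apply: JD. Qed.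
Local Lemma quot_oppE x : quot_opp (quot_proj x) = quot_proj (- x).
Proof. by apply/quot_projP; rewrite -opprD; apply: JN. Qed.
Local Lemma quot_mulE x y : quot_mul (quot_proj x) (quot_proj y) = quot_proj (x * y).
Proof.
apply/quot_projP; rewrite -(subrKA (x * repr (quot_proj y))) -mulrBl -mulrBr.
by apply: JD; [apply: JMr|apply: JMl].
Qed.
Local Lemma quot_scaleE a x : quot_scale a (quot_proj x) = quot_proj (a *: x).
Proof. by apply/quot_projP; rewrite -scalerBr; apply: JZ. Qed.
Local Lemma quot_starE x : quot_star (quot_proj x) = quot_proj (star x).
Proof. by apply/quot_projP; rewrite -starN -starD; apply: JS. Qed.

Ltac quot_tac :=
  repeat (let x := fresh "x" in elim/quot_ind => x);
  rewrite ?(quot_addE, quot_oppE, quot_mulE, quot_scaleE, quot_starE).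

Local Lemma quot_addA : associative quot_add.
Proof. by quot_tac; rewrite addrA. Qed.
Local Lemma quot_addC : commutative quot_add.
Proof. by quot_tac; rewrite addrC. Qed.
Local Lemma quot_add0 : left_id (quot_proj 0) quot_add.
Proof. by quot_tac; rewrite add0r. Qed.
Local Lemma quot_addN : left_inverse (quot_proj 0) quot_opp quot_add.
Proof. by quot_tac; rewrite addNr. Qed.
HB.instance Definition _ := GRing.isZmodule.Build starQuot quot_addA quot_addC quot_add0 quot_addN.

Local Lemma quot_mulA : associative quot_mul.
Proof. by quot_tac; rewrite mulrA. Qed.
Local Lemma quot_mul1 : left_id (quot_proj 1) quot_mul.
Proof. by quot_tac; rewrite mul1r. Qed.
Local Lemma quot_mulx1 : right_id (quot_proj 1) quot_mul.
Proof. by quot_tac; rewrite mulr1. Qed.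
Local Lemma quot_mulDl : left_distributive quot_mul quot_add.
Proof. by quot_tac; rewrite mulrDl. Qed.
Local Lemma quot_mulDr : right_distributive quot_mul quot_add.
Proof. by quot_tac; rewrite mulrDr. Qed.
Local Lemma one_neq0 : quot_proj 1 != quot_proj 0.
Proof. by apply/eqP => /quot_projP; rewrite subr0; apply: ideal_proper. Qed.
HB.instance Definition _ :=
  GRing.Zmodule_isNzRing.Build starQuot quot_mulA quot_mul1 quot_mulx1 quot_mulDl quot_mulDr one_neq0.

Local Lemma quot_scaleA a b x : quot_scale a (quot_scale b x) = quot_scale (a * b) x.
Proof. by elim/quot_ind: x => x; rewrite !quot_scaleE scalerA. Qed.
Local Lemma quot_scale1 : left_id 1 quot_scale.
Proof. by quot_tac; rewrite scale1r. Qed.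
Local Lemma quot_scaleDr : right_distributive quot_scale +%R.
Proof.
move=> a; elim/quot_ind => x; elim/quot_ind => y.
by rewrite [_ + _]quot_addE !quot_scaleE [RHS]quot_addE scalerDr.
Qed.
Local Lemma quot_scaleDl x : {morph quot_scale^~ x : a b / a + b}.
Proof. by move=> a b; elim/quot_ind: x => x; rewrite !quot_scaleE [RHS]quot_addE scalerDl. Qed.
HB.instance Definition _ :=
  GRing.Zmodule_isLmodule.Build C starQuot quot_scaleA quot_scale1 quot_scaleDr quot_scaleDl.

Local Lemma quot_scaleAl (a : C) (x y : starQuot) : a *: (x * y) = a *: x * y.
Proof.
elim/quot_ind: x => x; elim/quot_ind: y => y.
by rewrite [_ * _ in LHS]quot_mulE [LHS]quot_scaleE [_ *: _ in RHS]quot_scaleE [RHS]quot_mulE scalerAl.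
Qed.
HB.instance Definition _ := GRing.Lmodule_isLalgebra.Build C starQuot quot_scaleAl.

Local Lemma quot_scaleAr (a : C) (x y : starQuot) : a *: (x * y) = x * (a *: y).
Proof.
elim/quot_ind: x => x; elim/quot_ind: y => y.
by rewrite [_ * _ in LHS]quot_mulE [LHS]quot_scaleE [_ *: _ in RHS]quot_scaleE [RHS]quot_mulE scalerAr.
Qed.
HB.instance Definition _ := GRing.Lalgebra_isAlgebra.Build C starQuot quot_scaleAr.

Local Lemma qstarK : involutive quot_star.
Proof. by quot_tac; rewrite starK. Qed.
Local Lemma qstarD : {morph quot_star : x y / x + y}.
Proof.
elim/quot_ind => x; elim/quot_ind => y.
by rewrite [_ + _ in LHS]quot_addE !quot_starE [RHS]quot_addE starD.
Qed.
Local Lemma qstarZ (a : C) (x : starQuot) : quot_star (a *: x) = Num.conj a *: quot_star x.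
Proof.
elim/quot_ind: x => x.
by rewrite [_ *: _ in LHS]quot_scaleE !quot_starE [RHS]quot_scaleE starZ.
Qed.
Local Lemma qstarM (x y : starQuot) : quot_star (x * y) = quot_star y * quot_star x.
Proof.
elim/quot_ind: x => x; elim/quot_ind: y => y.
by rewrite [_ * _ in LHS]quot_mulE !quot_starE [RHS]quot_mulE starM.
Qed.
HB.instance Definition _ := isStarAlgebra.Build R starQuot qstarK qstarD qstarZ qstarM.

Lemma quot_projD x y : quot_proj (x + y) = quot_proj x + quot_proj y.
Proof. by rewrite [RHS]quot_addE. Qed.
Lemma quot_projZ (a : C) x : quot_proj (a *: x) = a *: quot_proj x.
Proof. by rewrite [RHS]quot_scaleE. Qed.
Lemma quot_projM x y : quot_proj (x * y) = quot_proj x * quot_proj y.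
Proof. by rewrite [RHS]quot_mulE. Qed.
Lemma quot_proj1 : quot_proj 1 = 1.
Proof. by []. Qed.
Lemma quot_proj_star x : quot_proj (star x) = star (quot_proj x).
Proof. by rewrite [RHS]quot_starE. Qed.

End Quotient.

Section PodlesSphere.
Variables (R : realType) (q : R) (c : \bar R).
Local Notation C := R[i].
Local Open Scope complex_scope.

(* The parameter -oo is treated like +oo; only c > 0 is ever used. *)
Definition podles_relation (F : starAlgType R) (A B : F) : set F := [set x |
  [\/ x = star A - A,
      x = B * A - (q ^+ 2)%:C *: (A * B),
      x = star B * B - (if c is r%:E then A - A ^+ 2 + r%:C%:A else 1 - A ^+ 2)
    | x = B * star B -
          (if c is r%:E then (q ^+ 2)%:C *: A - (q ^+ 4)%:C *: A ^+ 2 + r%:C%:A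
           else 1 - (q ^+ 4)%:C *: A ^+ 2)]].

(* The character A, A^* |-> 0, B |-> 1, B^* |-> gamma shows that the relations
   do not generate the unit ideal. *)
Local Definition gamma : C := if c is r%:E then r%:C else 1.

Local Lemma character_ideal (F : starAlgType R) (A B : F) (chi : F -> C) :
    (forall x y, chi (x + y) = chi x + chi y) ->
    (forall x y, chi (x * y) = chi x * chi y) ->
    (forall a x, chi (a *: x) = a * chi x) -> chi 1 = 1 ->
    chi A = 0 -> chi (star A) = 0 -> chi B = 1 -> chi (star B) = gamma ->
  ~ star_ideal_gen (podles_relation A B) 1.
Proof.
move=> chiD chiM chiZ chi1 chiA chiAs chiB chiBs.
have chi0 : chi 0 = 0 by rewrite -(scale0r 0) chiZ mul0r.
have chiN x : chi (- x) = - chi x by rewrite -scaleN1r chiZ mulN1r.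
have HJ : star_ideal [set x | chi x = 0 /\ chi (star x) = 0].
  split=> /=.
  - by rewrite star0.
  - by move=> x y [x0 sx0] [y0 sy0]; rewrite starD !chiD x0 y0 sx0 sy0 addr0.
  - by move=> x y [x0 sx0]; rewrite starM !chiM x0 sx0 mulr0 mul0r.
  - by move=> x y [x0 sx0]; rewrite starM !chiM x0 sx0 mulr0 mul0r.
  - by move=> x [x0 sx0]; rewrite starK.
have HR : podles_relation A B `<=` [set x | chi x = 0 /\ chi (star x) = 0].
  have chiE := (chiD, chiN, chiM, chiZ, chi1, chiA, chiB, chiAs, chiBs).
  have simpE := (mul0r, mulr0, subr0, add0r, oppr0, addr0, mulr1).
  have conjR (r : R) : Num.conj r%:C = r%:C by exact: conjc_real.
  move=> x [] ->; split.
  - by rewrite !chiE subr0.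
  - by rewrite starD starN starK !chiE subr0.
  - by rewrite !chiE !mulr0 mul0r mulr0 subr0.
  - by rewrite starD starN starZ !starM !chiE !mulr0 mul0r subr0.
  - rewrite chiD chiN chiM chiBs chiB mulr1 /gamma.
    by case: c => [r||]; rewrite expr2 !chiE !simpE subrr.
  - rewrite starD starN starM starK chiD chiN chiM chiBs chiB mulr1 /gamma.
    by case: c => [r||]; rewrite expr2 !starD !starN ?starZ !starM ?star1 ?conjR
      !chiE !simpE subrr.
  - rewrite chiD chiN chiM chiBs chiB mul1r /gamma.
    by case: c => [r||]; rewrite expr2 !chiE !simpE subrr.
  - rewrite starD starN starM starK chiD chiN chiM chiBs chiB mul1r /gamma.
    by case: c => [r||]; rewrite expr2 !starD !starN !starZ !starM ?star1 ?conjR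
      !chiE !simpE subrr.
move=> /(_ _ (conj HJ HR)) [/eqP].
by rewrite chi1 oner_eq0.
Qed.

Definition freeA : freeStar R bool := free_gen R false.
Definition freeB : freeStar R bool := free_gen R true.

Local Definition letter_val (l : bool * bool) : C :=
  if l.1 then (if l.2 then gamma else 1) else 0.
Local Definition word_val (w : word bool) : C := \prod_(l <- w : seq _) letter_val l.
Local Lemma word_val_morph : mmorphism word_val.
Proof.
split=> [v w|]; first by rewrite /word_val fmM big_cat.
by rewrite /word_val fm1 big_nil.
Qed.
HB.instance Definition _ :=
  monalg.isMultiplicative.Build (word bool) C word_val word_val_morph.

Local Lemma starGE i : star (free_gen R i) = mkmalgU (fmu (i, true)) 1 :> freeStar R bool.
Proof.
have -> : fmu (i, true) = word_star (fmu (i, false)).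
  by apply/eqP; rewrite fmP /word_star !fmE !fmU.
by rewrite [LHS]free_starU rmorph1.
Qed.

Fact podles_proper : ~ star_ideal_gen (podles_relation freeA freeB) 1.
Proof.
apply: (@character_ideal _ freeA freeB (mmap idfun word_val)).
- exact: mmapD.
- exact: rmorphM.
- exact: mmapZ.
- exact: mmap1.
- by rewrite mmapU /word_val fmU big_seq1 mulr0.
- by rewrite starGE mmapU /word_val fmU big_seq1 mulr0.
- by rewrite mmapU /word_val fmU big_seq1 mulr1.
- by rewrite starGE mmapU /word_val fmU big_seq1 mul1r.
Qed.

Definition podles_ideal : properStarIdeal (freeStar R bool) :=
  ProperStarIdeal (star_ideal_genP (podles_relation freeA freeB)) podles_proper.

Definition podles := starQuot podles_ideal.
HB.instance Definition _ := StarAlgebra.on podles.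

Definition podlesA : podles := quot_proj podles_ideal freeA.
Definition podlesB : podles := quot_proj podles_ideal freeB.

End PodlesSphere.

Definition circle (R : realType) : set R[i]^o := [set z | `|z| = 1].
Arguments circle R : clear implicits.

Section Operators.
Variables (R : realType) (H : hilbertType R).
Local Notation C := R[i].
Implicit Types (S T : H -> H) (M : set (H -> H)).

Definition bounded_op T : Prop :=
  linear T /\ exists K : C, forall v, `|T v| <= K * `|v|.

Definition opnorm T : R :=
  sup [set complex.Re `|T v| | v in [set v : H | `|v| <= 1]].

Definition adjoint T T' : Prop := forall u v, inner (T u) v = inner u (T' v).

Definition star_representation (P : starAlgType R) (pi : P -> H -> H) : Prop :=
  [/\ forall x, bounded_op (pi x), linear pi, pi 1 = idfun,
      forall x y, pi (x * y) = pi x \o pi y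
    & forall x, adjoint (pi x) (pi (star x))].

(* Unital C^*-algebras of bounded operators on H. *)
Definition operator_cstar M : Prop :=
  [/\ M `<=` bounded_op, M idfun,
      (forall (a : C) T T', M T -> M T' -> M (a *: T + T')) /\
        (forall T T', M T -> M T' -> M (T \o T')),
      (forall T T', M T -> adjoint T T' -> M T')
    & forall T, bounded_op T ->
        (forall eps : R, 0 < eps -> exists2 T', M T' & opnorm (T - T') < eps) ->
        M T].

Definition cstar_gen S : set (H -> H) :=
  \bigcap_(M in [set M | operator_cstar M /\ M S]) M.

Definition orthonormal_basis (e : nat -> H) : Prop :=
  (forall i j, inner (e i) (e j) = (i == j)%:R) /\
  dense [set v | exists (n : nat) (a : nat -> C), v = \sum_(i < n) a i *: e i].

Definition is_shift (e : nat -> H) S : Prop :=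
  bounded_op S /\ forall i, S (e i) = e i.+1.

(* sigma is the symbol map on C^*(S); its values off C^*(S) are irrelevant. *)
Definition is_symbol S (sigma : (H -> H) -> circle R -> C^o) : Prop :=
  [/\ (forall T, cstar_gen S T -> continuous (sigma T)),
      sigma idfun = cst 1 /\ sigma S = set_val,
      forall (a : C) T T', cstar_gen S T -> cstar_gen S T' ->
        sigma (a *: T + T') = (fun z => a * sigma T z + sigma T' z),
      forall T T', cstar_gen S T -> cstar_gen S T' ->
        sigma (T \o T') = (fun z => sigma T z * sigma T' z)
    & forall T T', cstar_gen S T -> adjoint T T' ->
        sigma T' = (fun z => Num.conj (sigma T z))].

Definition fiber_product S (sigma : (H -> H) -> circle R -> C^o) :
    set ((H -> H) * (H -> H)) :=
  [set p | [/\ cstar_gen S p.1, cstar_gen S p.2 & sigma p.1 = sigma p.2]].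

End Operators.

Section CStarClosure.
Variable R : realType.

Definition star_morphism (P Q : starAlgType R) (f : P -> Q) : Prop :=
  [/\ linear f, f 1 = 1, {morph f : x y / x * y} & {morph f : x / star x}].

Definition star_automorphism (P : starAlgType R) (f : P -> P) : Prop :=
  star_morphism f /\ bijective f.

Definition universal_norm (P : starAlgType R) (x : P) : \bar R :=
  ereal_sup [set r | exists (H : hilbertType R) (pi : P -> H -> H),
    star_representation pi /\ r = (opnorm (pi x))%:E].

(* E, with iota : P -> E, is the completion of P (modulo the null space) in
   the universal norm; in particular that norm is finite. *)
Definition cstar_closure (P : starAlgType R) (E : cstarAlgType R) (iota : P -> E) :
    Prop :=
  [/\ star_morphism iota,
      forall x, (cnorm (iota x))%:E = universal_norm x
    & forall (y : E) (eps : R), 0 < eps -> exists x, cnorm (y - iota x) < eps].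

End CStarClosure.

Section PodlesRepresentations.
Variables (R : realType) (q : R) (c : \bar R).
Local Open Scope complex_scope.

(* The sign +/- is encoded by a boolean, with true for -. *)
Definition podles_lambda (b : bool) : R :=
  if c is r%:E then 2^-1 + (-1) ^+ b * Num.sqrt (r + 4^-1) else (-1) ^+ b.

Definition podles_coef (b : bool) (k : nat) : R :=
  if c is r%:E then
    podles_lambda b * q ^+ (2 * k) - (podles_lambda b * q ^+ (2 * k)) ^+ 2 + r
  else 1 - q ^+ (4 * k).

Definition is_podles_rep (H : hilbertType R) (e : nat -> H) (E : cstarAlgType R)
    (iota : podles q c -> E) (b : bool) (pi : E -> H -> H) : Prop :=
  [/\ star_representation pi,
      forall k, pi (iota (podlesA q c)) (e k) =
                (podles_lambda b * q ^+ (2 * k))%:C *: e k,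
      pi (iota (podlesB q c)) (e 0) = 0
    & forall k, pi (iota (podlesB q c)) (e k.+1) =
                (Num.sqrt (podles_coef b k.+1))%:C *: e k].

End PodlesRepresentations.

Section Reflection.
Variables (T : Type) (Eoo Ec : zmodType).

Definition rep_sum (E : Type) (pip pim : E -> T) : E -> T * T :=
  fun x => (pip x, pim x).

Definition flip (ab : T * T) : T * T := (ab.2, ab.1).

Variables (Phioo : Eoo -> T * T) (Phic : Ec -> T * T).

(* Inverses are taken with pinv; they are the actual inverse maps as soon as
   Phioo and Phic are bijections onto the same set. *)
Definition rbar1 : Eoo -> Eoo :=
  'pinv_(fun=> 0) setT Phioo \o flip \o Phioo.

Definition chi : Ec -> Eoo := 'pinv_(fun=> 0) setT Phioo \o Phic.

Definition rbar1c : Ec -> Ec := 'pinv_(fun=> 0) setT chi \o rbar1 \o chi.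

End Reflection.

(* Main.v *)
Require Import Defs.
From HB Require Import structures.
From mathcomp Require Import all_boot all_order all_algebra.
From mathcomp Require Import sesquilinear.
From mathcomp Require Import all_classical all_reals all_analysis.
From mathcomp Require Import complex lra.
From mathcomp Require Import -(notations) monalg.

Set Implicit Arguments.
Unset Strict Implicit.
Unset Printing Implicit Defensive.

Import Order.TTheory GRing.Theory Num.Theory numFieldNormedType.Exports.

Local Open Scope classical_set_scope.
Local Open Scope ring_scope.

(** Both representations carry the U(1)-action by one and the same diagonal
    unitary: with h = g^2 and U e_k = h^-k e_k, one has
    pi_±(delta_g x) = U pi_±(x) U^-1 for every x.  The flip exchanges the two
    components of pi_+ ⊕ pi_-, and conjugation by U treats them alike, so the
    two operations commute; as the reflection is the flip transported along
    the bijection pi_+ ⊕ pi_- ([rbar1c_flip]), it commutes with delta_g.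

    The operator U itself is never built.  Conjugation by U is read on matrix
    coefficients: the (i, j) coefficient is multiplied by h^j / h^i
    ([phase_conjugate]).  This suffices because a bounded operator is
    determined by its coefficients in an orthonormal basis
    ([bounded_op_ext]).  The coefficient relation is established in three
    stages.  A monomial in A, B and their adjoints sends each basis vector to
    a multiple of a basis vector, and for such elements the relation is
    multiplicative ([phase_monomialM]), so it only has to be checked on the
    generators.  Linear combinations of monomials exhaust the polynomial
    algebra ([freeStar_span]).  Finally both sides are continuous in x
    ([phase_conjugate_closed]) and the polynomials are dense.

    Continuity is automatic: every star representation of a C*-algebra is
    contractive ([representation_contractive]).  If |x| < 1 then 1 - x^* x is
    a square s^2 with s selfadjoint ([cstar_sqrt]), hence
    |v|^2 - |pi(x) v|^2 = |pi(s) v|^2 >= 0. *)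

(** * Square roots in C*-algebras *)

Section CStarSquareRoot.
Variables (R : realType) (E : cstarAlgType R).
Implicit Types x y z a : E.

Lemma cnormZr (t : R) x : 0 <= t -> cnorm (t%:C%C *: x) = t * cnorm x.
Proof. by move=> t0; rewrite cnormZ ger0_norm ?lecR. Qed.

Lemma cnorm0 : cnorm (0 : E) = 0.
Proof. by rewrite -(scale0r (0 : E)) (cnormZr _ (lexx 0)) mul0r. Qed.

Lemma cnormN x : cnorm (- x) = cnorm x.
Proof. by rewrite -scaleN1r cnormZ normrN1 mul1r. Qed.

Lemma cdistC x y : cnorm (x - y) = cnorm (y - x).
Proof. by rewrite -cnormN opprB. Qed.

Lemma cnorm_ge0 x : 0 <= cnorm x.
Proof.
have := cnormD x (- x).
by rewrite subrr cnorm0 cnormN -mulr2n pmulrn_lge0.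
Qed.

Lemma cnorm_starE x : cnorm (star x) = cnorm x.
Proof.
suff le y : cnorm y <= cnorm (star y).
  by apply/le_anti; rewrite le -{2}(starK x) le.
have [y0|yn0] := eqVneq (cnorm y) 0; first by rewrite y0 cnorm_ge0.
have := cnormM (star y) y; rewrite cnorm_star expr2 ler_pM2r //.
by rewrite lt_def yn0 cnorm_ge0.
Qed.

Lemma cnorm_small x : (forall eps : R, 0 < eps -> cnorm x < eps) -> x = 0.
Proof.
move=> small; apply: cnorm_eq0; apply/le_anti; rewrite cnorm_ge0 andbT.
by apply/ler_addgt0Pl => eps eps0; rewrite addr0 ltW // small.
Qed.

(** A fixed point l of this map satisfies l + l = a + l^2, that is,
    (1 - l)^2 = 1 - a.  When |a| < 1 the map is a contraction of the ball of
    radius |a|, so iterating it from 0 replaces the binomial series of the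
    square root. *)
Definition sqrt_step a z : E := 2^-1%:C%C *: (a + z * z).

Section Iteration.
Variables (a : E) (sa : star a = a) (a1 : cnorm a < 1).
Local Notation F := (sqrt_step a).
Local Notation r := (cnorm a).
Local Notation y n := (iter n F 0).

Lemma sqrt_step_bound z : cnorm z <= r -> cnorm (F z) <= r.
Proof.
move=> zr; rewrite cnormZr ?invr_ge0// ler_pdivrMl//.
rewrite (le_trans (cnormD _ _))// mulr_natl mulr2n lerD2l.
rewrite (le_trans (cnormM _ _))//.
rewrite (le_trans (ler_pM (cnorm_ge0 z) (cnorm_ge0 z) zr zr))//.
by rewrite ler_piMr ?cnorm_ge0// ltW.
Qed.

(** z^2 - w^2 = z (z - w) + (z - w) w, which needs no commutation. *)
Lemma sqrt_step_lip z w : cnorm z <= r -> cnorm w <= r ->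
  cnorm (F z - F w) <= r * cnorm (z - w).
Proof.
move=> zr wr; rewrite /sqrt_step -scalerBr cnormZr ?invr_ge0// ler_pdivrMl//.
have -> : a + z * z - (a + w * w) = z * (z - w) + (z - w) * w.
  by rewrite opprD addrACA subrr add0r mulrBr mulrBl addrA subrK.
rewrite (le_trans (cnormD _ _))// mulr_natl mulr2n lerD//.
  by rewrite (le_trans (cnormM _ _))// ler_wpM2r ?cnorm_ge0.
by rewrite mulrC (le_trans (cnormM _ _))// ler_wpM2l ?cnorm_ge0// mulrC.
Qed.

Lemma sqrt_iter_bound n z : cnorm z <= r -> cnorm (iter n F z) <= r.
Proof. by move=> zr; elim: n => //= n; exact: sqrt_step_bound. Qed.

Lemma sqrt_iter_lip n z w : cnorm z <= r -> cnorm w <= r ->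
  cnorm (iter n F z - iter n F w) <= r ^+ n * cnorm (z - w).
Proof.
move=> zr wr; elim: n => [|n IH] /=; first by rewrite expr0 mul1r.
rewrite (le_trans (sqrt_step_lip (sqrt_iter_bound _ _) (sqrt_iter_bound _ _)))//.
by rewrite exprS -mulrA ler_wpM2l ?cnorm_ge0.
Qed.

Lemma sqrt_iter_star n : star (y n) = y n.
Proof.
elim: n => [|n /= IH]; first exact: star0.
by rewrite /sqrt_step starZ starD starM sa IH [Num.conj _]conjc_real.
Qed.

(** iter m and iter N compare by N applications of the contraction to the pair
    (iter (m - N), 0), which lies in the ball of radius |a| < 1. *)
Lemma sqrt_iter_cauchy (eps : R) : 0 < eps -> exists N : nat, forall m n : nat,
  (N <= m)%N -> (N <= n)%N -> cnorm (y m - y n) < eps.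
Proof.
move=> eps0; have y0 : cnorm (0 : E) <= r by rewrite cnorm0 cnorm_ge0.
have e2 : 0 < eps / 2 by rewrite divr_gt0.
have /cvgr0Pnorm_lt/(_ _ e2)[N _ HN] : (r ^+ n) @[n --> \oo] --> 0.
  by apply: cvg_expr; rewrite ger0_norm ?cnorm_ge0.
have near_yN m : (N <= m)%N -> cnorm (y m - y N) < eps / 2.
  move=> Nm; have := HN N (leqnn N); rewrite /= ger0_norm ?exprn_ge0 ?cnorm_ge0//.
  apply: le_lt_trans; rewrite -(subnKC Nm) iterD.
  have yb := sqrt_iter_bound (m - N) y0.
  rewrite (le_trans (sqrt_iter_lip _ yb y0))// subr0.
  by rewrite ler_piMr ?exprn_ge0 ?cnorm_ge0// (le_trans yb)// ltW.
exists N => m n Nm Nn; rewrite -(subrKA (y N)) (splitr eps).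
by rewrite (le_lt_trans (cnormD _ _))// ltrD ?near_yN// cdistC near_yN.
Qed.

(** The root is 1 - l, where l is the limit of the iterates; l is selfadjoint
    because they are and the involution is isometric. *)
Lemma cstar_sqrt : exists s : E, star s = s /\ s * s = 1 - a.
Proof.
have [l yl] := cnorm_complete _ sqrt_iter_cauchy.
have close (eps : R) : 0 < eps -> exists n,
    cnorm (y n - l) < eps /\ cnorm (y n.+1 - l) < eps.
  move=> eps0; have /cvgr0Pnorm_lt/(_ _ eps0)[N _ HN] := yl.
  exists N; split; rewrite -[ltLHS]ger0_norm ?cnorm_ge0//; apply: HN => //=.
have y0 : cnorm (0 : E) <= r by rewrite cnorm0 cnorm_ge0.
have lr : cnorm l <= r.
  apply/ler_addgt0Pl => eps /close[n [nl _]].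
  rewrite -(subrK (y n) l) (le_trans (cnormD _ _))// lerD ?sqrt_iter_bound//.
  by rewrite ltW// cdistC.
have sl : star l = l.
  apply/eqP; rewrite -subr_eq0; apply/eqP/cnorm_small => eps eps0.
  have /close[n [nl _]] : 0 < eps / 2 by rewrite divr_gt0.
  rewrite -(subrKA (y n)) (splitr eps) (le_lt_trans (cnormD _ _))// ltrD//.
  by rewrite -(sqrt_iter_star n) -starN -starD cnorm_starE cdistC.
have Fl : F l = l.
  apply/eqP; rewrite -subr_eq0; apply/eqP/cnorm_small => eps eps0.
  have /close[n [nl nl1]] : 0 < eps / 2 by rewrite divr_gt0.
  rewrite -(subrKA (y n.+1)) (splitr eps) (le_lt_trans (cnormD _ _))// ltrD//.
  rewrite (le_lt_trans (sqrt_step_lip _ _)) ?sqrt_iter_bound// cdistC.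
  by rewrite (le_lt_trans _ nl)// ler_piMl ?cnorm_ge0// ltW.
exists (1 - l); split; first by rewrite starD starN star1 sl.
have l2 : a + l * l = l + l.
  rewrite -[in RHS]Fl /sqrt_step -scalerDl -rmorphD /=.
  have -> : 2^-1 + 2^-1 = 1 :> R by rewrite [RHS](splitr 1) div1r.
  by rewrite scale1r.
have -> : 1 - a = 1 - (l + l - l * l) by rewrite -l2 addrK.
by rewrite mulrBr mulr1 mulrBl mul1r !opprB opprD -addrA [- l + _]addrCA.
Qed.

End Iteration.
End CStarSquareRoot.

(** * Star representations are contractive *)

Section StarRepresentations.
Variables (R : realType) (H : hilbertType R).
Local Notation C := R[i].

Lemma star_representation_comp (P Q : starAlgType R) (f : P -> Q)
    (pi : Q -> H -> H) :
  star_morphism f -> star_representation pi -> star_representation (pi \o f).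
Proof.
move=> [fL f1 fM fS] [piB piL pi1 piM piS]; split=> /=.
- by move=> x; exact: piB.
- by move=> a x y /=; rewrite fL piL.
- by rewrite f1.
- by move=> x y; rewrite fM piM.
- by move=> x; rewrite fS; exact: piS.
Qed.

Section Linearity.
Variables (P : starAlgType R) (pi : P -> H -> H).
Hypothesis pi_rep : star_representation pi.

Lemma representation0 : pi 0 = 0.
Proof.
case: pi_rep => _ piL _ _ _.
by have := piL (-1) 0 0; rewrite scaler0 addr0 scaleN1r addNr.
Qed.

Lemma representationZ (a : C) x : pi (a *: x) = a *: pi x.
Proof.
by case: pi_rep => _ piL _ _ _; rewrite -[a *: x]addr0 piL representation0 addr0.
Qed.

Lemma representationB x y : pi (x - y) = pi x - pi y.
Proof.
case: pi_rep => _ piL _ _ _.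
by rewrite [x - y]addrC -[- y]scaleN1r piL scaleN1r addrC.
Qed.

Lemma representation_scale x (a : C) v : pi x (a *: v) = a *: pi x v.
Proof.
case: pi_rep => piB _ _ _ _; have [xL _] := piB x.
pose f := HB.pack_for {linear H -> H} (pi x) (GRing.isLinear.Build _ _ _ _ _ xL).
by rewrite -[pi x]/(f : H -> H) linearZ.
Qed.

End Linearity.

Variables (E : cstarAlgType R) (pi : E -> H -> H).
Hypothesis pi_rep : star_representation pi.

(** With s^2 = 1 - x^* x and s = s^*, the defect |v|^2 - |pi(x) v|^2 is
    <v, pi(s^2) v> = |pi(s) v|^2. *)
Lemma representation_contractive1 x v : cnorm x < 1 -> `|pi x v| <= `|v|.
Proof.
case: pi_rep => _ _ pi1 piM piS x1.
have [||s [ss s2]] := @cstar_sqrt _ E (star x * x).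
- by rewrite starM starK.
- by rewrite cnorm_star expr_lt1 ?cnorm_ge0.
have normE y : `|pi y v| ^+ 2 = inner v (pi (star y * y) v).
  by rewrite norm_inner piS piM.
rewrite -(ler_pXn2r (ltn0Sn 1)) ?nnegrE// -subr_ge0 normE norm_inner.
have -> : inner v v - inner v (pi (star x * x) v) = `|pi s v| ^+ 2.
  have -> : inner v v = inner v (pi 1 v) by rewrite pi1.
  by rewrite normE ss s2 -linearBr /= representationB.
exact: exprn_ge0.
Qed.

(** The strict bound t, in place of cnorm x itself, avoids dividing by 0. *)
Lemma representation_contractive x (t : R) v :
  cnorm x < t -> `|pi x v| <= t%:C%C * `|v|.
Proof.
move=> xt; have t0 : 0 < t by exact: le_lt_trans (cnorm_ge0 x) xt.
have tC : 0 < t%:C%C :> C by rewrite ltcR.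
rewrite -ler_pdivrMl// -[_^-1]gtr0_norm ?invr_gt0// -normrZ.
have -> : (t%:C%C)^-1 = (t^-1)%:C%C :> C by rewrite fmorphV.
have := @representation_contractive1 ((t^-1)%:C%C *: x) v; rewrite representationZ//; apply.
by rewrite cnormZr ?invr_ge0 ?ltW// ltr_pdivrMl// mulr1.
Qed.

End StarRepresentations.

(** * Matrix coefficients in an orthonormal basis *)

Lemma innerZl (R : realType) (H : hilbertType R) (a : R[i]) (u v : H) :
  inner (a *: u) v = a * inner u v.
Proof. by rewrite linearZl_LR. Qed.

Section OrthonormalBasis.
Variables (R : realType) (H : hilbertType R) (e : nat -> H).
Local Notation C := R[i].
Hypothesis he : orthonormal_basis e.
Implicit Types (u v w : H) (T : H -> H).

Lemma basis_span_close v (eps : C) : 0 < eps ->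
  exists n (a : nat -> C), `|v - \sum_(i < n) a i *: e i| < eps.
Proof.
case: he => _ dns eps0.
have [|w [/= vw [n [a wE]]]] := dns (ball v eps) _ (ball_open v eps).
  by exists v; exact: ballxx.
by exists n, a; move: vw; rewrite wE -ball_normE.
Qed.

(** A vector v orthogonal to all e_k is orthogonal to their span, so by
    Pythagoras no element of the span is closer to v than 0 is; density then
    leaves only v = 0. *)
Lemma basis_orthogonal0 v : (forall k, inner v (e k) = 0) -> v = 0.
Proof.
move=> ve; apply/eqP; rewrite -normr_eq0; apply: contraT => v0.
have vgt0 : 0 < `|v| by rewrite lt_def v0 normr_ge0.
have [n [a]] := basis_span_close v vgt0.
set w := \sum_(i < n) _ => vw.
have iw : inner v w = 0.
  by rewrite linear_sum big1// => i _; rewrite linearZ /= ve mulr0.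
have : `|v - w| ^+ 2 < `|v| ^+ 2 by rewrite ltr_pXn2r ?nnegrE.
rewrite !norm_inner dnormB iw rmorph0 addr0 subr0 -!norm_inner.
by rewrite le_gtF// lerDl exprn_ge0.
Qed.

Lemma coef_le_norm v k : `|inner v (e k)| <= `|v|.
Proof.
set a := inner v (e k).
have ek : inner (e k) (e k) = 1 by rewrite he.1 eqxx.
have orth : inner (v - a *: e k) (a *: e k) = 0.
  by rewrite linearZ /= linearBl linearZl_LR /= ek mulr1 subrr mulr0.
rewrite -(ler_pXn2r (ltn0Sn 1)) ?nnegrE// norm_inner -[v in leRHS](subrK (a *: e k)).
rewrite dnormD orth rmorph0 !addr0 dnormZ ek mulr1 -norm_inner.
by rewrite lerDr exprn_ge0.
Qed.

(** The bound in [bounded_op] is an arbitrary complex number, which need not be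
    nonnegative when H = 0. *)
Lemma bounded_op_norm T : bounded_op T ->
  exists2 K : C, 0 <= K & forall v, `|T v| <= K * `|v|.
Proof.
move=> [_ [K TK]]; exists `|K| => // v.
have := TK v; rewrite -{2}[`|v|]normr_id -normrM => /le_trans; apply.
by rewrite ger0_norm// (le_trans _ (TK v)).
Qed.

(** T and T' agree on the dense span of the basis, and T - T' is Lipschitz
    with constant K + K' (1 is added below to have a nonzero divisor). *)
Lemma bounded_op_ext T T' : bounded_op T -> bounded_op T' ->
  (forall i j, inner (T (e j)) (e i) = inner (T' (e j)) (e i)) -> T = T'.
Proof.
move=> bT bT' TT'.
have TeT' j : T (e j) = T' (e j).
  apply/eqP; rewrite -subr_eq0; apply/eqP/basis_orthogonal0 => k.
  by rewrite linearBl /= TT' subrr.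
have [K K0 TK] := bounded_op_norm bT; have [K' K'0 TK'] := bounded_op_norm bT'.
case: bT bT' => TL _ [TL' _].
pose f := HB.pack_for {linear H -> H} T (GRing.isLinear.Build _ _ _ _ T TL).
pose f' := HB.pack_for {linear H -> H} T' (GRing.isLinear.Build _ _ _ _ T' TL').
apply/funext => v; apply/eqP; rewrite -subr_eq0 -normr_eq0; apply: contraT => D0.
have Dgt0 : 0 < `|T v - T' v| by rewrite lt_def D0 normr_ge0.
have L0 : 0 < K + K' + 1 by rewrite ltr_wpDl// addr_ge0.
have [|n [a]] := @basis_span_close v (`|T v - T' v| / (K + K' + 1)).
  by rewrite divr_gt0.
set w := \sum_(i < n) _; rewrite ltr_pdivlMr// => vw.
have Tw : T w = T' w.
  rewrite -[T]/(f : H -> H) -[T']/(f' : H -> H) !linear_sum.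
  by apply: eq_bigr => i _; rewrite !linearZ /= TeT'.
have DE : T v - T' v = T (v - w) - T' (v - w).
  rewrite -[T]/(f : H -> H) -[T']/(f' : H -> H) !linearB /= Tw.
  by rewrite opprK [- _ + _]addrC addrA subrK.
have := lt_irreflexive `|T v - T' v|; rewrite (le_lt_trans _ vw)//.
rewrite {1}DE (le_trans (ler_normB _ _))// mulrC mulrDl mul1r ler_wpDr//.
by rewrite mulrDl lerD.
Qed.

End OrthonormalBasis.

(** * Conjugation by a diagonal unitary *)

Section PhaseShift.
Variables (R : realType) (H : hilbertType R) (e : nat -> H).
Local Notation C := R[i].
Hypothesis he : orthonormal_basis e.
Variables (E : cstarAlgType R) (rho1 rho2 : E -> H -> H).
Hypotheses (rep1 : star_representation rho1) (rep2 : star_representation rho2).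
Variable h : C.
Hypothesis h1 : `|h| = 1.

(** On elements x for which rho1 x maps every basis vector to a multiple of a
    basis vector: rho2 x is the conjugate of rho1 x by the diagonal unitary
    e_k |-> h^-k e_k.  Unlike [phase_conjugate], this form is visibly stable
    under products, no infinite sum over intermediate indices being needed. *)
Definition phase_monomial (x : E) : Prop := forall j, exists i (a : C),
  rho1 x (e j) = a *: e i /\ rho2 x (e j) = (h ^+ j / h ^+ i * a) *: e i.

(** The same relation for arbitrary elements, in terms of matrix
    coefficients, where it is stable under linear combinations and limits. *)
Definition phase_conjugate (x : E) : Prop := forall i j,
  inner (rho2 x (e j)) (e i) = h ^+ j / h ^+ i * inner (rho1 x (e j)) (e i).

Lemma phase_neq0 : h != 0.
Proof. by rewrite -normr_eq0 h1 oner_eq0. Qed.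

Lemma phase_unit n : h ^+ n \is a GRing.unit.
Proof. by rewrite unitfE expf_neq0 ?phase_neq0. Qed.

Lemma phase_monomial1 : phase_monomial 1.
Proof.
case: rep1 rep2 => _ _ r1 _ _ [_ _ r2 _ _] j.
by exists j, 1; rewrite r1 r2 mulr1 divrr ?phase_unit// !scale1r.
Qed.

(** The phases telescope: (h^j / h^i) (h^i / h^k) = h^j / h^k. *)
Lemma phase_monomialM x y :
  phase_monomial x -> phase_monomial y -> phase_monomial (x * y).
Proof.
move=> px py j; have [i [a [y1 y2]]] := py j; have [k [b [x1 x2]]] := px i.
exists k, (a * b); case: (rep1) (rep2) => _ _ _ m1 _ [_ _ _ m2 _].
rewrite m1 m2 /= y1 y2 !representation_scale// x1 x2 !scalerA; split=> //.
congr (_ *: _); rewrite mulrACA; congr (_ * _).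
by rewrite mulrA divrK ?phase_unit.
Qed.

Lemma phase_monomial_conjugate x : phase_monomial x -> phase_conjugate x.
Proof.
move=> px i j; have [k [a [-> ->]]] := px j.
rewrite !innerZl he.1; case: eqVneq => [->|_]; last by rewrite !mulr0.
by rewrite !mulr1.
Qed.

Lemma phase_conjugate0 : phase_conjugate 0.
Proof.
by move=> i j; rewrite !representation0// linear0l mulr0.
Qed.

Lemma phase_conjugate_lin (a : C) x y :
  phase_conjugate x -> phase_conjugate y -> phase_conjugate (a *: x + y).
Proof.
move=> px py i j; case: rep1 rep2 => _ l1 _ _ _ [_ l2 _ _ _].
rewrite l1 l2 /= !linearDl /= !innerZl px py mulrDr.
by rewrite mulrCA.
Qed.

(** Coefficients of contractive representations are 1-Lipschitz and the phase
    has modulus 1: if y is within d / 4 of x and satisfies the relation, the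
    defect d of x is at most d / 4 + d / 4. *)
Lemma phase_conjugate_closed (x : E) :
  (forall eps : R, 0 < eps -> exists2 y, phase_conjugate y & cnorm (x - y) < eps) ->
  phase_conjugate x.
Proof.
move=> close i j; apply/eqP; rewrite -subr_eq0 -normr_eq0; apply: contraT => D0.
set D := `|_| in D0.
have Dgt0 : 0 < D by rewrite lt_def D0 normr_ge0.
pose d := complex.Re D.
have DE : D = d%:C%C by rewrite RRe_real// ger0_real// ltW.
have d0 : 0 < d by rewrite -ltcR -DE.
have [|y py xy] := close (d / 4); first by rewrite divr_gt0.
have near_coef (rho : E -> H -> H) : star_representation rho ->
    `|inner (rho x (e j)) (e i) - inner (rho y (e j)) (e i)| <= (d / 4)%:C%C.
  move=> rep; rewrite -linearBl /= (le_trans (coef_le_norm he _ _))//.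
  have -> : rho x (e j) - rho y (e j) = rho (x - y) (e j).
    by rewrite representationB.
  rewrite (le_trans (representation_contractive rep _ xy))//.
  suff -> : `|e j| = 1 by rewrite mulr1.
  by apply/eqP; rewrite -(@eqrXn2 _ 2)// norm_inner he.1 eqxx expr1n.
have phase1 : `|h ^+ j / h ^+ i| = 1.
  by rewrite normrM normrV ?phase_unit// !normrX h1 !expr1n invr1 mulr1.
have : D <= (d / 4)%:C%C + (d / 4)%:C%C.
  rewrite /D -(subrKA (inner (rho2 y (e j)) (e i))) (le_trans (ler_normD _ _))//.
  rewrite lerD ?near_coef// py -mulrBr normrM phase1 mul1r distrC near_coef//.
rewrite DE -rmorphD /= lecR => dd.
by have := lt_irreflexive d; rewrite (le_lt_trans dd)//; lra.
Qed.

(** The adjoint of a backward weighted shift is the forward shift with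
    conjugate weights; the two sides are compared by pairing with all e_k. *)
Lemma weighted_shift_adjoint (rho : E -> H -> H) (b : E) (beta : nat -> C) :
    star_representation rho -> rho b (e 0) = 0 ->
    (forall k, rho b (e k.+1) = beta k *: e k) ->
  forall j, rho (star b) (e j) = Num.conj (beta j) *: e j.+1.
Proof.
move=> [_ _ _ _ adj] b0 bS j; apply/eqP; rewrite -subr_eq0; apply/eqP.
apply: (basis_orthogonal0 he) => k; rewrite linearBl /= linearZl_LR /=.
rewrite adj starK he.1; case: k => [|k]; first by rewrite b0 linear0 mulr0 subrr.
by rewrite bS linearZ /= he.1 eqSS; case: eqVneq => [->|_]; rewrite ?mulr0 subrr.
Qed.

(** The case of the generator B, a backward shift that the action multiplies
    by h.  For b^* the factor is the conjugate of h, which is h^-1 as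
    |h| = 1, and this is the phase h^j / h^(j+1) of a forward shift. *)
Lemma phase_monomial_shift (b : E) (beta : nat -> C) :
    rho1 b (e 0) = 0 -> (forall k, rho1 b (e k.+1) = beta k *: e k) ->
    (forall v, rho2 b v = h *: rho1 b v) ->
  phase_monomial b /\ phase_monomial (star b).
Proof.
move=> b0 bS b2; split=> j.
  case: j => [|k]; first by exists 0%N, 0; rewrite b2 b0 mulr0 scale0r scaler0.
  exists k, (beta k); rewrite b2 bS scalerA; split=> //.
  by rewrite exprS mulrK ?phase_unit.
exists j.+1, (Num.conj (beta j)); split; first exact: weighted_shift_adjoint.
rewrite (@weighted_shift_adjoint _ _ (fun k => h * beta k))//.
- rewrite rmorphM; congr (_ * _ *: _).
  have hh : h * Num.conj h = 1 by rewrite -normCK h1 expr1n.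
  rewrite exprS invrM ?phase_unit ?unitfE ?phase_neq0// mulrA divrr ?phase_unit// mul1r.
  by apply: (mulfI phase_neq0); rewrite hh divff ?phase_neq0.
- by rewrite b2 b0 scaler0.
- by move=> k; rewrite b2 bS scalerA.
Qed.

End PhaseShift.

(** * Monomials span the free star algebra *)

Section Monomials.
Variables (R : realType) (I : choiceType).
Local Notation C := R[i].
Local Notation FA := (freeStar R I).

(** Induction along monomials, then along linear combinations: D is a property
    of monomials, Q a linear property that need not be multiplicative. *)
Lemma freeStar_span (D Q : FA -> Prop) :
    D 1 -> (forall x y, D x -> D y -> D (x * y)) ->
    (forall i, D (free_gen R i)) -> (forall i, D (star (free_gen R i))) ->
    Q 0 -> (forall a x y, D x -> Q y -> Q (a *: x + y)) ->
  forall x, Q x.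
Proof.
move=> D1 DM Dg Ds Q0 QZ x.
have Dw (w : word I) : D (mkmalgU w 1).
  case: w; elim=> [|[i b] s IH]; first by rewrite -fmoneE.
  have -> : mkmalgU (FMonom ((i, b) :: s)) 1 =
      mkmalgU (fmu (i, b)) 1 * mkmalgU (FMonom s) 1 :> FA.
    rewrite [RHS]mkmalgUM mulr1; congr mkmalgU.
    by apply/eqP; rewrite fmP fmM fmU.
  apply: DM => //.
  case: b; last exact: Dg.
  have -> : fmu (i, true) = word_star (fmu (i, false)).
    by apply/eqP; rewrite fmP /word_star !fmE !fmU.
  by have := Ds i; rewrite [star _]free_starU rmorph1.
rewrite [x]monalgE; elim: (finmap.enum_fset _) => [|w s IH].
  by rewrite big_nil.
rewrite big_cons; have -> : mkmalgU w (mcoeff w x) = mcoeff w x *: mkmalgU w 1.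
  by apply/malgP => v; rewrite [RHS]mcoeffZ !mcoeffU mulr_natr.
exact: QZ.
Qed.

End Monomials.

(** * The reflection as a transported flip *)

Section FlipTransport.
Variables (T : Type) (Eoo Ec : zmodType).
Variables (Phioo : Eoo -> T * T) (Phic : Ec -> T * T) (F : set (T * T)).
Hypotheses (bijoo : set_bij setT F Phioo) (bijc : set_bij setT F Phic).
Hypothesis flipF : forall p, F p -> F (flip p).

(** Every [pinv] is applied to a value of the function that it inverts, hence
    is a genuine preimage: F is the common image of Phioo and Phic, and the
    flip preserves F. *)
Lemma rbar1c_flip x : Phic (rbar1c Phioo Phic x) = flip (Phic x).
Proof.
have [imoo _ surjoo] := bijoo; have [imc _ surjc] := bijc.
have PhiK p : F p -> Phioo ('pinv_(fun=> 0) setT Phioo p) = p.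
  by move=> Fp; apply: (surjpK (fun=> 0) surjoo); rewrite inE.
have Fc z : F (Phic z) by exact: imc.
have chiE z : Phioo (chi Phioo Phic z) = Phic z by exact: PhiK.
have [y0 _ y0E] := surjc _ (flipF (Fc x)).
have rE : rbar1 Phioo (chi Phioo Phic x) = chi Phioo Phic y0.
  by rewrite /rbar1 /= chiE /chi /= y0E.
have chirK : chi Phioo Phic (rbar1c Phioo Phic x) = chi Phioo Phic y0.
  rewrite -rE; apply: (@pinvK _ _ (fun=> 0) setT (chi Phioo Phic)).
  by rewrite inE rE; exists y0.
by rewrite -chiE chirK chiE y0E.
Qed.

End FlipTransport.

(** * The circle action on the Podles sphere *)

Section Podles.
Variables (R : realType) (q : R) (c : \bar R).
Local Notation C := R[i].

Lemma star_podlesA : star (podlesA q c) = podlesA q c.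
Proof.
rewrite -[LHS]quot_proj_star; apply/quot_projP.
by move=> J [_]; apply; apply: Or41.
Qed.

Variables (E : cstarAlgType R) (iota : podles q c -> E).
Hypothesis iotaE : cstar_closure iota.
Variables (H : hilbertType R) (e : nat -> H).
Hypothesis he : orthonormal_basis e.
Variables (delta : E -> E) (g : C).
Hypotheses (g1 : `|g| = 1) (deltaM : star_morphism delta).
Hypotheses (deltaA : delta (iota (podlesA q c)) = iota (podlesA q c))
  (deltaB : delta (iota (podlesB q c)) = g ^+ 2 *: iota (podlesB q c)).

(** The phase h = g^2 is the same for both signs b; this uniformity is what
    makes the action commute with the flip. *)
Lemma podles_rotation b (pi : E -> H -> H) : is_podles_rep e iota b pi ->
  forall x, phase_conjugate e pi (pi \o delta) (g ^+ 2) x.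
Proof.
move=> [rep piA piB0 piBS] x.
have rep' := star_representation_comp deltaM rep.
have h1 : `|g ^+ 2| = 1 by rewrite normrX g1 expr1n.
case: iotaE => [[iL i1 iM iS] _ dns].
apply: (phase_conjugate_closed he rep rep' h1) => eps eps0.
have [p xp] := dns x eps eps0; exists (iota p) => // {x eps eps0 xp}.
pose D f := phase_monomial e pi (pi \o delta) (g ^+ 2) (iota (quot_proj _ f)).
pose Q f := phase_conjugate e pi (pi \o delta) (g ^+ 2) (iota (quot_proj _ f)).
have iota0 : iota 0 = 0.
  by have := iL (-1) 0 0; rewrite scaler0 addr0 scaleN1r addNr.
have DA : phase_monomial e pi (pi \o delta) (g ^+ 2) (iota (podlesA q c)).
  move=> j; exists j; eexists; rewrite /= deltaA piA; split; first by [].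
  by rewrite divrr ?mul1r// unitfE expf_neq0// -normr_eq0 h1 oner_eq0.
have pi_deltaB v : (pi \o delta) (iota (podlesB q c)) v =
    g ^+ 2 *: pi (iota (podlesB q c)) v by rewrite /= deltaB representationZ.
have [DB DBs] := phase_monomial_shift he rep rep' h1 piB0 piBS pi_deltaB.
rewrite -[p]quot_projK.
apply: (@freeStar_span _ _ D Q).
- by rewrite /D quot_proj1 i1; exact: phase_monomial1.
- by move=> u v Du Dv; rewrite /D quot_projM iM; exact: phase_monomialM.
- by case.
- case; first by rewrite /D quot_proj_star iS.
  by rewrite /D quot_proj_star iS -[quot_proj _ _]/(podlesA q c) -iS star_podlesA.
- rewrite /Q -[0](scale0r 0) quot_projZ scale0r iota0.
  exact: phase_conjugate0.
- move=> a u v Du Qv; rewrite /Q quot_projD quot_projZ iL.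
  by apply: phase_conjugate_lin => //; exact: phase_monomial_conjugate.
Qed.

End Podles.

Theorem mainTheorem7 (R : realType) (q : R) (hq : 0 < `|q| < 1)
  (* the C^*-algebras C(S^2_{qc}), for all c in (0, +oo] *)
  (E : \bar R -> cstarAlgType R)
  (iota : forall c : \bar R, podles q c -> E c)
  (hE : forall c : \bar R, (0 < c)%E -> cstar_closure (iota c))
  (* the representations pi^c_+ and pi^c_- *)
  (H : hilbertType R) (e : nat -> H) (he : orthonormal_basis e)
  (pip pim : forall c : \bar R, E c -> H -> H)
  (hpip : forall c : \bar R, (0 < c)%E -> is_podles_rep e (iota c) false (pip c))
  (hpim : forall c : \bar R, (0 < c)%E -> is_podles_rep e (iota c) true (pim c))
  (* the shift, the symbol map, and the isomorphism onto the fiber product *)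
  (S : H -> H) (hS : is_shift e S)
  (sigma : (H -> H) -> circle R -> (R[i])^o) (hsigma : is_symbol S sigma)
  (hiso : forall c : \bar R, (0 < c)%E ->
     set_bij setT (fiber_product S sigma) (rep_sum (pip c) (pim c)))
  (* c in (0, +oo] and the U(1)-action delta on C(S^2_{qc}) *)
  (c : \bar R) (hc : (0 < c)%E)
  (delta : R[i] -> E c -> E c)
  (hdelta : forall g : R[i], `|g| = 1 ->
     [/\ star_automorphism (delta g),
         delta g (iota c (podlesA q c)) = iota c (podlesA q c)
       & delta g (iota c (podlesB q c)) = g ^+ 2 *: iota c (podlesB q c)]) :
  let r1c := rbar1c (rep_sum (pip +oo%E) (pim +oo%E)) (rep_sum (pip c) (pim c)) in
  forall g : R[i], `|g| = 1 -> delta g \o r1c = r1c \o delta g.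
Proof.
move=> r1c g g1; have [[dM _] dA dB] := hdelta g g1.
have flipF p : fiber_product S sigma p -> fiber_product S sigma (flip p).
  by case=> ? ? ?; split.
have r1cE := rbar1c_flip (hiso +oo%E (ltry 0)) (hiso c hc) flipF.
have [_ inj _] := hiso c hc.
apply/funext => x /=; apply: inj; rewrite ?inE// r1cE.
have [pipE pimE] := r1cE x.
have rot := podles_rotation (hE c hc) he g1 dM dA dB.
have bounded b pi y : is_podles_rep e (iota c) b pi -> bounded_op (pi y).
  by case=> -[].
rewrite /flip /rep_sum /=; congr (_, _); apply: (bounded_op_ext he) => [||i j];
  try by apply: bounded; first [exact: hpip|exact: hpim].
  have := rot _ _ (hpip c hc) (r1c x) i j; rewrite /= => ->.
  have := rot _ _ (hpim c hc) x i j; rewrite /= => ->.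
  by rewrite pipE.
have := rot _ _ (hpim c hc) (r1c x) i j; rewrite /= => ->.
have := rot _ _ (hpip c hc) x i j; rewrite /= => ->.
by rewrite pimE.
Qed.
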